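(* There exist constants $C,\alpha>0$ such that the following holds for every $n\in\mathbb{N}$. If $G$ is a $d$-regular bipartite graph on $2n$ vertices with $d\geq(1-\alpha)n$, then there exists a $(C\log n/n)$-spread probability distribution on $1$-factorizations of $G$.
   Context: A $1$-factorization of a $d$-regular graph $G$ is an ordered partition $(M_1,\dots,M_d)$ of $E(G)$ into perfect matchings. A probability distribution on $1$-factorizations $(M_1,\dots,M_d)$ of a $d$-regular bipartite graph $G$ is $q$-spread if for all $S_1,\dots,S_d\subseteq E(G)$ we have $\Pr[S_i\subseteq M_i \text{ for all } i\in[d]]\leq q^{\sum_{i=1}^d|S_i|}$.
   Formalization: The statement is proved for every n ≥ 2: at n = 1 we have log n = 0, so the claim fails for the single edge K_2 (its only 1-factorization has probability 1 > 0), and at n = 0 the quantity log n / n is undefined. *)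

(* Defs.v *)
From HB Require Import structures.
From mathcomp Require Import all_boot all_order all_algebra.
From mathcomp Require Import reals exp.

Set Implicit Arguments.
Unset Strict Implicit.
Unset Printing Implicit Defensive.

Import Order.TTheory GRing.Theory Num.Theory.

Local Open Scope ring_scope.

Record simple_graph (V : finType) := SimpleGraph {
  adj :> rel V;
  adj_sym : symmetric adj;
  adj_irr : irreflexive adj }.

Section Graphs.
Variables (V : finType) (G : simple_graph V).

Definition edges : {set {set V}} :=
  [set f : {set V} | [exists x, exists y, G x y && (f == [set x; y])]].

Definition regular (d : nat) : Prop := forall x : V, #|[set y | G x y]| = d.

Definition bipartite : Prop :=
  exists A : {set V}, forall x y : V, G x y -> (x \in A) != (y \in A).

Definition perfect_matching (M : {set {set V}}) : bool :=
  (M \subset edges) && [forall x : V, #|[set f in M | x \in f]| == 1%N].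

(* The parts of a partition must be nonempty. This is not required separately:
   a perfect matching of a graph with at least one vertex is nonempty. *)
Definition is_one_factorization (d : nat)
    (M : {ffun 'I_d -> {set {set V}}}) : bool :=
  [&& [forall i, perfect_matching (M i)],
      [forall i, forall j, (i != j) ==> [disjoint M i & M j]] &
      \bigcup_i M i == edges].

Definition one_factorization (d : nat) : finType :=
  {M : {ffun 'I_d -> {set {set V}}} | is_one_factorization M}.

End Graphs.

Record fdist (R : realType) (A : finType) := FDist {
  pmf :> A -> R;
  pmf_ge0 : forall a, 0 <= pmf a;
  pmf_sum1 : \sum_(a : A) pmf a = 1 }.

Definition Pr (R : realType) (A : finType) (mu : fdist R A) (E : pred A) : R :=
  \sum_(a : A | E a) mu a.

Definition spread (R : realType) (V : finType) (G : simple_graph V) (d : nat)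
    (q : R) (mu : fdist R (one_factorization G d)) : Prop :=
  forall S : 'I_d -> {set {set V}},
    (forall i, S i \subset edges G) ->
    Pr mu (fun M => [forall i, S i \subset sval M i])
      <= q ^+ (\sum_(i < d) #|S i|)%N.

(* Main.v *)
(** A [D]-regular bipartite edge-expander is cut at random into two halves of
    degrees [D/2] (up to rounding), and the halves are cut recursively until
    their degrees are of order [log n]; then König's theorem splits them into
    perfect matchings in an arbitrary way.

    For one cut, every edge is independently committed to one of the two halves
    with probability [(1 - eps)/2] each, and left free with probability [eps].
    With high probability, a max-flow argument distributes the free edges so
    that both halves are regular, and both inherit the expansion of the graph:
    the requirements concern edge cuts, all of which are concentrated because a
    vertex set [Z] is left by at least [g |Z|] edges. Whatever choice the flow
    makes, a set [T] of edges is distributed in a prescribed way with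
    probability at most [((1 + eps)/2)^|T|], since every edge of [T] must be
    free or committed to the right half. The values of [eps] along the
    recursion are summable, so the losses multiply to a constant. *)
Require Import Defs.
From HB Require Import structures.
From mathcomp Require Import all_boot all_order all_algebra.
From mathcomp Require Import zify ring lra.
From mathcomp Require Import reals sequences exp.

Set Implicit Arguments.
Unset Strict Implicit.
Unset Printing Implicit Defensive.

Import Order.TTheory GRing.Theory Num.Theory.

Local Open Scope ring_scope.

(** * Flows *)

Section Flow.
Variables (E V : finType) (src tgt : E -> V).
Implicit Types (F R : {set E}) (Z : {set V}) (u v w : V).

Definition net_flow F v : int :=
  \sum_(e in F) ((src e == v)%:Z - (tgt e == v)%:Z).

Lemma sum_eq_mem Z v : \sum_(w in Z) ((v == w)%:Z : int) = (v \in Z)%:Z.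
Proof.
case: (boolP (v \in Z)) => vZ.
  rewrite (bigD1 v) //= eqxx big1 ?addr0 // => w /andP[_ wv].
  by rewrite eq_sym (negbTE wv).
by rewrite big1 // => w wZ; case: eqP => // vw; rewrite vw wZ in vZ.
Qed.

Lemma sum_net F Z :
  \sum_(v in Z) net_flow F v = \sum_(e in F) ((src e \in Z)%:Z - (tgt e \in Z)%:Z).
Proof.
rewrite exchange_big /=; apply: eq_bigr => e _.
by rewrite sumrB !sum_eq_mem.
Qed.

Definition residual R F u w : bool :=
  [exists e in R, if e \in F then (tgt e == u) && (src e == w)
                  else (src e == u) && (tgt e == w)].

Lemma net_setU1 F e v : e \notin F ->
  net_flow (e |: F) v = net_flow F v + (src e == v)%:Z - (tgt e == v)%:Z.
Proof. by move=> eF; rewrite /net_flow big_setU1 //=; ring. Qed.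

Lemma net_setD1 F e v : e \in F ->
  net_flow (F :\ e) v = net_flow F v - (src e == v)%:Z + (tgt e == v)%:Z.
Proof.
by move=> eF; rewrite /net_flow [in RHS](big_setD1 e) //=; ring.
Qed.

(* Reversing the first arc of a simple path affects no other arc of the path. *)
Lemma augment R F u p : F \subset R -> path (residual R F) u p -> uniq (u :: p) ->
  exists2 F' : {set E}, F' \subset R &
    forall v, net_flow F' v = net_flow F v + (u == v)%:Z - (last u p == v)%:Z.
Proof.
elim: p u F => [|w p IH] u F FR /=.
  by move=> _ _; exists F => // v; lia.
case/andP=> /existsP[e /andP[eR he]] pathp /andP[un unp].
pose F1 := if e \in F then F :\ e else e |: F.
have F1R : F1 \subset R.
  rewrite /F1; case: ifP => _; first exact: subset_trans (subsetDl _ _) FR.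
  by rewrite subUset sub1set eR.
have net1 v : net_flow F1 v = net_flow F v + (u == v)%:Z - (w == v)%:Z.
  rewrite /F1; case: ifP he => eF /andP[/eqP <- /eqP <-].
    by rewrite net_setD1 //; lia.
  by rewrite net_setU1 ?eF.
have path1 : path (residual R F1) w p.
  have agree e' : e' != e -> (e' \in F1) = (e' \in F).
    by move=> ne; rewrite /F1; case: ifP => _; rewrite !inE ?ne // (negbTE ne).
  have ue : (src e == u) || (tgt e == u).
    by case: ifP he => _ /andP[-> _]; rewrite ?orbT.
  have uwp : u \notin w :: p by [].
  elim: p w pathp uwp {IH unp un he net1} => //= x p IH w /andP[rwx pp].
  rewrite !inE !negb_or => /and3P[uw ux up].
  rewrite IH ?inE ?negb_or ?ux ?andbT //.
  case/existsP: rwx => e' /andP[e'R h]; apply/existsP; exists e'; rewrite e'R /=.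
  rewrite agree //; apply: contraTneq ue => <-; rewrite negb_or.
  case: ifP h => _ /andP[/eqP -> /eqP ->];
  by rewrite [w == u]eq_sym [x == u]eq_sym uw ux.
have [F' F'R net'] := IH w F1 F1R path1 unp.
by exists F' => // v; rewrite net' net1; lia.
Qed.

(** Gale's supply-demand theorem with unit capacities. A flow of least total error [Phi] has error
    zero: otherwise either an augmenting path lowers [Phi], or some vertex set violates the cut
    condition. *)
Lemma gale R (b : V -> int) : \sum_v b v = 0 ->
  (forall Z, \sum_(v in Z) b v
     <= \sum_(e in R) ((src e \in Z) && (tgt e \notin Z))%:Z) ->
  exists2 F : {set E}, F \subset R & forall v, net_flow F v = b v.
Proof.
move=> b0 hZ.
pose Phi F := (\sum_v `|(b v - net_flow F v)%R|)%N.
have s0 : set0 \subset R by rewrite sub0set.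
case: (@arg_minnP _ set0 (fun F : {set E} => F \subset R) Phi s0) => F FR Fmin.
exists F => //.
have tot : \sum_v (b v - net_flow F v) = 0.
  rewrite sumrB b0 (eq_bigl (mem [set: V])) => [|v]; last by rewrite !inE.
  by rewrite sum_net big1 ?subr0 // => e _; rewrite !inE.
move=> v1; apply/eqP; apply: contraT => nv1.
have [v0 v0P] : exists v0, b v0 - net_flow F v0 > 0.
  have [/existsP//|/existsPn nn] := boolP [exists v0, 0 < b v0 - net_flow F v0].
  have : \sum_v (net_flow F v - b v) == 0.
    by rewrite -oppr_eq0 -sumrN -[X in _ == X]tot; apply/eqP/eq_bigr => v _; ring.
  rewrite psumr_eq0 => [/allP/(_ v1 (mem_index_enum _))|v _].
    by rewrite subr_eq0 (negbTE nv1).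
  by move: (nn v); lia.
(* If [b] is below the net flow somewhere in [Z], a residual path from [v0] to that vertex lowers
   [Phi]. Otherwise every arc of [R] leaving [Z] is used and no arc of [F] enters [Z], so the net
   flow out of [Z] is its full capacity and still below the supply. *)
pose Z := [set w | connect (residual R F) v0 w].
have v0Z : v0 \in Z by rewrite inE connect0.
case: (boolP [exists w in Z, b w - net_flow F w < 0]) => [/existsP[w /andP[]]|].
  rewrite inE => /connectP[p0 pp0 ->] {w}.
  case/shortenP: pp0 => p pp up _ neg.
  have [F' F'R net'] := augment FR pp up.
  have v0w : v0 != last v0 p by apply: contraTneq neg => <-; lia.
  have : (Phi F' < Phi F)%N.
    rewrite /Phi [X in (X < _)%N](bigD1 v0) //= [X in (_ < X)%N](bigD1 v0) //=.
    rewrite -addSn leq_add //.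
      by rewrite net' eqxx (eq_sym _ v0) (negbTE v0w); lia.
    apply: leq_sum => v vv0; rewrite net' (eq_sym v0) (negbTE vv0).
    case: eqP => [<-|_]; rewrite ?addr0 ?subr0 //.
    by move: (b _) (net_flow _ _) neg => x y; lia.
  by rewrite ltnNge Fmin.
rewrite negb_exists => /forallP nonneg.
have exZ : 0 < \sum_(v in Z) (b v - net_flow F v).
  rewrite (bigD1 v0) //=; apply: ltr_wpDr => //; apply: sumr_ge0 => v /andP[vZ _].
  by have := nonneg v; rewrite vZ -leNgt.
have := hZ Z.
suff -> : \sum_(e in R) ((src e \in Z) && (tgt e \notin Z))%:Z = \sum_(v in Z) net_flow F v.
  by rewrite leNgt -subr_gt0 -sumrB exZ.
rewrite sum_net (big_setID F) /= (setIidPr FR) [X in _ + X]big1 ?addr0.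
  apply: eq_bigr => e eF.
  case: (boolP (tgt e \in Z)) => tZ; last by rewrite andbT subr0.
  suff -> : src e \in Z by [].
  move: tZ; rewrite !inE => /connect_trans; apply; apply: connect1.
  by apply/existsP; exists e; rewrite (subsetP FR) // eF !eqxx.
move=> e; rewrite inE => /andP[eF eR].
apply/eqP; rewrite eqz_nat eqb0; apply/negP => /andP[]; rewrite !inE => sZ.
move/negP; apply; apply: connect_trans sZ (connect1 _).
by apply/existsP; exists e; rewrite eR (negbTE eF) !eqxx.
Qed.

End Flow.

(** * Regular subgraphs of bipartite graphs *)

Definition lab (E : finType) (L : eqType) (w : E -> L) (F : {set E}) (x : L) : {set E} :=
  [set e in F | w e == x].

Section Bipartite.
Variables (E V : finType) (src tgt : E -> V) (A : {set V}).
Hypotheses (srcA : forall e, src e \in A) (tgtA : forall e, tgt e \notin A).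
Implicit Types (F R : {set E}) (Z : {set V}) (v : V).

Definition edge_cut F Z : nat := (\sum_(e in F) ((src e \in Z) != (tgt e \in Z)))%N.

(** There are no loops, as [src] lies in [A] and [tgt] outside. Treating degrees as cuts of
    singletons makes every fact about cuts available for degrees. *)
Definition degree F v := edge_cut F [set v].

Notation net := (net_flow src tgt).

Definition sign v : int := if v \in A then 1 else -1.

Lemma cutC F Z : edge_cut F (~: Z) = edge_cut F Z.
Proof. by apply: eq_bigr => e _; rewrite !inE; case: (_ \in Z); case: (_ \in Z). Qed.

Lemma cut_lab (w : E -> option bool) F Z :
  edge_cut F Z = (edge_cut (lab w F (Some false)) Z + edge_cut (lab w F (Some true)) Z
            + edge_cut (lab w F None) Z)%N.
Proof.
rewrite /edge_cut (bigID (fun e => w e == None)) /= addnC; congr (_ + _)%N; last first.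
  by apply: eq_bigl => e; rewrite inE.
rewrite (bigID (fun e => w e == Some false)) /=; congr (_ + _)%N;
by apply: eq_bigl => e; rewrite inE -andbA; case: (w e) => [[]|].
Qed.

Lemma cutD F R Z : R \subset F -> edge_cut F Z = (edge_cut R Z + edge_cut (F :\: R) Z)%N.
Proof. by move=> RF; rewrite /edge_cut (big_setID R) /= (setIidPr RF). Qed.

Lemma cut_sub F R Z : R \subset F -> (edge_cut R Z <= edge_cut F Z)%N.
Proof. by move=> RF; rewrite (cutD _ RF) leq_addr. Qed.

Lemma netU F R v : [disjoint F & R] -> net (F :|: R) v = net F v + net R v.
Proof. by move=> FR; rewrite /net_flow -bigU //; apply: eq_bigl => e; rewrite inE. Qed.

Lemma net_deg F v : net F v = sign v * (degree F v)%:Z.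
Proof.
rewrite /degree /edge_cut (big_morph Posz PoszD (erefl _)) mulr_sumr.
apply: eq_bigr => e _; rewrite !inE /sign.
case: eqP => [<-|_]; case: eqP => [te|_]; rewrite ?srcA ?(mulr0, mulr1) //=.
by move: (tgtA e) (srcA e); rewrite te => /negbTE ->.
Qed.

(** This translates between the arcs leaving [Z], which [gale] bounds, and undirected cuts, which
    expansion bounds. *)
Lemma sum_net_out_cut F Z : \sum_(v in Z) net F v + (edge_cut F Z)%:Z =
  (\sum_(e in F) ((src e \in Z) && (tgt e \notin Z))%:Z) *+ 2.
Proof.
rewrite sum_net /edge_cut (big_morph Posz PoszD (erefl _)) -big_split -sumrMnl /=.
by apply: eq_bigr => e _; case: (_ \in Z); case: (_ \in Z).
Qed.

Lemma sum_netT F : \sum_v net F v = 0.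
Proof.
rewrite (eq_bigl (mem [set: V])) => [|v]; last by rewrite !inE.
by rewrite sum_net big1 // => e _; rewrite !inE.
Qed.

Lemma sum_net_regular F D Z : (forall v, degree F v = D) ->
  \sum_(v in Z) net F v = (\sum_(v in Z) sign v) * D%:Z.
Proof. by move=> regF; rewrite mulr_suml; apply: eq_bigr => v _; rewrite net_deg regF. Qed.

Lemma sum_sign_regular F D : (forall v, degree F v = D) -> (\sum_v sign v) * D%:Z = 0.
Proof.
move=> regF; rewrite -[RHS](sum_netT F) mulr_suml; apply: eq_bigr => v _.
by rewrite net_deg regF.
Qed.

Lemma sign_inj v (m n : nat) : sign v * m%:Z = sign v * n%:Z -> m = n.
Proof. by rewrite /sign; case: ifP => _; lia. Qed.

(** A perfect matching is a flow with supply [sign]. The cut condition holds because [D] times the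
    supply of [Z] is the net flow of [F] out of [Z]. *)
Lemma perfect_matching_regular F D : (forall v, degree F v = D) -> (0 < D)%N ->
  exists2 M : {set E}, M \subset F & forall v, degree M v = 1%N.
Proof.
move=> regF D0; have [||M MF netM] := @gale _ _ src tgt F sign.
- by move/eqP: (sum_sign_regular regF); rewrite mulf_eq0 => /orP[/eqP //|/eqP]; lia.
- move=> Z; have := sum_net_out_cut F Z; rewrite (sum_net_regular _ regF).
  have : \sum_(v in Z) net F v <= (edge_cut F Z)%:Z.
    rewrite sum_net /edge_cut (big_morph Posz PoszD (erefl _)); apply: ler_sum => e _.
    by case: (_ \in Z); case: (_ \in Z).
  rewrite (sum_net_regular _ regF).
  have : 0 <= \sum_(e in F) ((src e \in Z) && (tgt e \notin Z))%:Z by exact: sumr_ge0.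
  rewrite mulr2n; move: (\sum_(v in Z) _) (\sum_(e in F) _) (edge_cut F Z) => x y c.
  by clear -D0; nia.
by exists M => // v; apply: (@sign_inj v); rewrite -net_deg netM mulr1.
Qed.

(** The edges committed to [Some true] miss the degree [D./2] by about half the free degree, with
    error at most [m / 2] at each vertex. Hence half of the free edges is nearly the required flow,
    and the cuts of the free edges are large enough to route the remaining error. *)
Lemma split_regular F D (w : E -> option bool) (m : nat) : (forall v, degree F v = D) ->
  (forall v, degree (lab w F (Some true)) v < degree (lab w F (Some false)) v + m)%N ->
  (forall v, degree (lab w F (Some false)) v < degree (lab w F (Some true)) v + m)%N ->
  (forall Z, m * minn #|Z| #|~: Z| <= edge_cut (lab w F None) Z)%N ->
  exists F1 : {set E}, [/\ F1 \subset F, forall v, degree F1 v = D./2,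
    lab w F (Some true) \subset F1 & [disjoint lab w F (Some false) & F1]].
Proof.
move=> regF lt10 lt01 cutR.
set L1 := lab w F (Some true); set L0 := lab w F (Some false); set R := lab w F None.
pose b v : int := sign v * (D./2)%:Z - net L1 v.
have sb0 : \sum_v b v = 0.
  rewrite sumrB sum_netT subr0 -mulr_suml; have /eqP := sum_sign_regular regF.
  rewrite mulf_eq0 => /orP[/eqP ->|/eqP D0]; first by rewrite mul0r.
  by rewrite (_ : D = 0%N) ?mulr0 //; lia.
(* In terms of [k], the cut condition of [gale] reads [k(Z) <= cut R Z]. *)
pose k v : int := b v *+ 2 - net R v.
(* The strictness of [lt10] and [lt01] absorbs the unit lost in [D./2] when [D] is odd. *)
have kle v : `|k v| <= m%:Z.
  rewrite /k /b !net_deg; have := cut_lab w F [set v].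
  move: (lt10 v) (lt01 v); rewrite -!/(degree _ v) regF -/L0 -/L1 -/R /sign.
  rewrite mulr2n; move: (degree L1 v) (degree L0 v) (degree R v) => x y z.
  by clear; case: (v \in A); lia.
have sk0 : \sum_v k v = 0 by rewrite sumrB sum_netT sumrMnl sb0.
have ksum Z : \sum_(v in Z) k v <= m%:Z * #|Z|%:Z.
  apply: le_trans (_ : \sum_(v in Z) m%:Z <= _).
    by apply: ler_sum => v _; move: (kle v); lia.
  by rewrite sumr_const -mulr_natr natz.
have ksumC Z : \sum_(v in Z) k v <= m%:Z * #|~: Z|%:Z.
  have -> : \sum_(v in Z) k v = \sum_(v in ~: Z) - k v.
    apply/eqP; rewrite sumrN -addr_eq0 -[X in _ == X]sk0 [X in _ == X](bigID (mem Z)) /=.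
    by apply/eqP; congr (_ + _); apply: eq_bigl => v; rewrite inE.
  apply: le_trans (_ : \sum_(v in ~: Z) m%:Z <= _).
    by apply: ler_sum => v _; move: (kle v); lia.
  by rewrite sumr_const -mulr_natr natz.
have [//||F' F'R netF'] := @gale _ _ src tgt R b.
  move=> Z; have := sum_net_out_cut R Z; rewrite mulr2n; have := cutR Z.
  move: (ksum Z) (ksumC Z); rewrite sumrB sumrMnl mulr2n -/R.
  move: (\sum_(v in Z) b v) (\sum_(v in Z) net R v) (\sum_(e in R) _) (edge_cut R Z).
  by move=> x y z c; have [le|lt] := leqP #|Z| #|~: Z|; lia.
have dis : [disjoint L1 & F'].
  rewrite disjoint_sym; apply: disjointWl F'R _; rewrite -setI_eq0; apply/eqP/setP => e.
  by rewrite !inE; case: (w e) => [[]|]; rewrite ?andbF.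
exists (L1 :|: F'); split.
- by rewrite subUset (subset_trans F'R) ?andbT; apply/subsetP => e; rewrite inE => /andP[].
- move=> v; apply: (@sign_inj v); rewrite -net_deg netU // netF' /b; ring.
- exact: subsetUl.
rewrite -setI_eq0; apply/eqP/setP => e; rewrite !inE.
case: (boolP (e \in F')) => [/(subsetP F'R)|_]; rewrite ?inE;
by case: (w e) => [[]|]; rewrite ?andbF.
Qed.

End Bipartite.

(** * Random edge colourings *)

Section Colouring.
Variables (E V : finType) (src tgt : E -> V) (A : {set V}).
Hypotheses (srcA : forall e, src e \in A) (tgtA : forall e, tgt e \notin A).
Variables (R : realType) (d : nat).
Implicit Types (F : {set E}) (v : V).

Notation deg := (degree src tgt).
Notation colouring := {ffun E -> 'I_d.+1}.

(* The perfect matchings are the colour classes [o, ..., o + D - 1]. *)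
Definition factorizes F o D (c : colouring) : Prop :=
  (forall e, e \in F -> o <= c e < o + D)%N /\
  (forall v (i : 'I_d.+1), (o <= i < o + D)%N -> deg (lab c F i) v = 1%N).

Definition glue F1 (c : colouring * colouring) : colouring :=
  [ffun e => if e \in F1 then c.2 e else c.1 e].

Lemma factorizes_glue F F1 o D0 D1 c0 c1 : F1 \subset F ->
  factorizes (F :\: F1) o D0 c0 -> factorizes F1 (o + D0) D1 c1 ->
  factorizes F o (D0 + D1) (glue F1 (c0, c1)).
Proof.
move=> F1F [range0 one0] [range1 one1]; split=> [e eF|v i].
  rewrite ffunE /=; case: ifP => eF1; first by have := range1 e eF1; lia.
  by have := range0 e; rewrite inE eF1 eF => /(_ isT); lia.
move=> /andP[oi iD]; have [lt|le] := ltnP i (o + D0).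
  rewrite -(one0 v i) ?oi //; congr (deg _ v); apply/setP => e.
  rewrite !inE ffunE /=; case: (boolP (e \in F1)) => //= eF1.
  by apply/negP => /andP[_ /eqP ci]; have := range1 e eF1; rewrite ci; lia.
rewrite -(one1 v i) ?le ?addnA //; last by lia.
congr (deg _ v); apply/setP => e.
rewrite !inE ffunE /=; case: (boolP (e \in F1)) => /= eF1; first by rewrite (subsetP F1F).
case: (boolP (e \in F)) => //= eF; apply/eqP => ci.
by have := range0 e; rewrite inE eF1 eF ci => /(_ isT); lia.
Qed.

Lemma ord_between (o : nat) (i : 'I_d.+1) : (o <= i < o + 1)%N -> i = inord o.
Proof. by move=> h; apply: val_inj; rewrite /= inordK; have := ltn_ord i; lia. Qed.

(** König's theorem: remove a perfect matching, give it the colour [o], and recurse on the rest with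
    the colours from [o.+1] on. *)
Lemma koenig D F o : (forall v, deg F v = D) -> (o + D <= d.+1)%N ->
  exists c : colouring, factorizes F o D c.
Proof.
elim: D F o => [|D IH] F o regF oD.
  exists [ffun=> ord0]; split=> [e eF|v i]; last by lia.
  have := regF (src e); rewrite /degree /edge_cut (bigD1 e) //= !inE eqxx.
  by case: (tgt e =P src e) => [te|_ //]; have := tgtA e; rewrite te srcA.
have [//|//|M MF regM] := @perfect_matching_regular _ _ _ _ A srcA tgtA F D.+1.
have [v||c cP] := IH (F :\: M) o.+1.
- by have := regF v; rewrite /degree (cutD _ _ _ MF) -/(degree _ _ M v) regM => -[].
- by rewrite addSn -addnS.
exists (glue (F :\: M) ([ffun=> inord o], c)); rewrite -add1n.
apply: factorizes_glue; rewrite ?subsetDl ?addn1 //.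
rewrite setDDr setDv set0U (setIidPr MF); split=> [e _|v i h].
  by rewrite ffunE inordK; lia.
rewrite -(regM v); congr (deg _ v); apply/setP => e.
by rewrite !inE ffunE (ord_between h) eqxx andbT.
Qed.

Definition agrees (T : {set E}) (s : E -> 'I_d.+1) (c : colouring) : bool :=
  [forall e in T, c e == s e].

(** The bound may depend on the prescribed colours [s], and not only on [T]: once the two halves of
    [F] are fixed, a prescription incompatible with them has probability zero. *)
Definition random_factorization F o D (B : {set E} -> (E -> 'I_d.+1) -> R) : Prop :=
  exists mu : colouring -> R, [/\ forall c, 0 <= mu c, \sum_c mu c = 1,
    forall c, mu c != 0 -> factorizes F o D c &
    forall (T : {set E}) s, T \subset F -> \sum_(c | agrees T s c) mu c <= B T s].

Lemma random_factorization_koenig D F o : (forall v, deg F v = D) ->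
  (o + D <= d.+1)%N -> random_factorization F o D (fun _ _ => 1).
Proof.
move=> regF oD; have [c0 c0P] := koenig regF oD.
exists (fun c => (c == c0)%:R); split=> [c||c|T s _].
- by case: eqP.
- by rewrite (bigD1 c0) //= eqxx big1 ?addr0 // => c /negbTE ->.
- by case: (c =P c0) => [->|]; rewrite ?eqxx.
rewrite -[X in _ <= X](_ : \sum_c (c == c0)%:R = 1); last first.
  by rewrite (bigD1 c0) //= eqxx big1 ?addr0 // => c /negbTE ->.
by rewrite [X in _ <= X](bigID (agrees T s)) /= lerDl sumr_ge0.
Qed.

Lemma random_factorization_mix (Omega : finType) (wt : Omega -> R) F o D
    (B : Omega -> {set E} -> (E -> 'I_d.+1) -> R) :
  (forall w, 0 <= wt w) -> \sum_w wt w = 1 ->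
  (forall w, wt w != 0 -> random_factorization F o D (B w)) ->
  random_factorization F o D (fun T s => \sum_w wt w * B w T s).
Proof.
move=> wt0 wt1 h.
have /fin_all_exists [mu muP] w : exists mu : colouring -> R, wt w != 0 ->
    [/\ forall c, 0 <= mu c, \sum_c mu c = 1,
    forall c, mu c != 0 -> factorizes F o D c &
    forall (T : {set E}) s, T \subset F -> \sum_(c | agrees T s c) mu c <= B w T s].
  (* An outcome of weight zero may admit no law; it gets the zero function, which its weight
     cancels. *)
  have [_|w0] := eqVneq (wt w) 0; first by exists (fun _ => 0).
  by have [mu ?] := h w w0; exists mu.
have term0 w c : 0 <= wt w * mu w c.
  have [->|/muP[? _ _ _]] := eqVneq (wt w) 0; first by rewrite mul0r.
  by rewrite mulr_ge0.
exists (fun c => \sum_w wt w * mu w c); split=> [c||c|T s TF].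
- exact: sumr_ge0.
- rewrite exchange_big /= -wt1; apply: eq_bigr => w _; rewrite -mulr_sumr.
  have [->|/muP[_ -> _ _]] := eqVneq (wt w) 0; first by rewrite mul0r.
  by rewrite mulr1.
- rewrite psumr_neq0 // => /hasP[w _ /=]; rewrite lt0r mulf_eq0 negb_or.
  by case/andP=> /andP[w0 c0] _; have [_ _ + _] := muP w w0; apply.
rewrite exchange_big /=; apply: ler_sum => w _; rewrite -mulr_sumr.
have [->|/muP[_ _ _ hB]] := eqVneq (wt w) 0; first by rewrite !mul0r.
by rewrite ler_wpM2l // hB.
Qed.

Lemma sum_preimage (I J : finType) (g : I -> J) (P : pred J) (f : I -> R) :
  \sum_(j | P j) \sum_(i | g i == j) f i = \sum_(i | P (g i)) f i.
Proof.
rewrite [RHS](partition_big g P) //; apply: eq_bigr => j Pj.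
by apply: eq_bigl => i; case: eqP => [->|]; rewrite ?Pj ?andbF.
Qed.

(** The halves are coloured independently. Colours from [o + D0] on occur only on [F1] and smaller
    ones only off [F1], so a prescription either contradicts the split or separates into two
    independent ones. *)
Lemma random_factorization_glue F F1 o D0 D1 (q : R) : F1 \subset F -> 0 <= q ->
  random_factorization (F :\: F1) o D0 (fun T _ => q ^+ #|T|) ->
  random_factorization F1 (o + D0) D1 (fun T _ => q ^+ #|T|) ->
  random_factorization F o (D0 + D1) (fun T s =>
    q ^+ #|T| * [forall e in T, (e \in F1) == (o + D0 <= s e)%N]%:R).
Proof.
move=> F1F q0 [mu0 [pos0 one0 supp0 spr0]] [mu1 [pos1 one1 supp1 spr1]].
exists (fun c => \sum_(p | glue F1 p == c) mu0 p.1 * mu1 p.2); split=> [c||c|T s TF].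
- by apply: sumr_ge0 => p _; rewrite mulr_ge0.
- rewrite (sum_preimage _ xpredT) -(pair_bigA _ (fun a b => mu0 a * mu1 b)) /=.
  rewrite -one0; apply: eq_bigr => c0 _.
  by rewrite -mulr_sumr one1 mulr1.
- rewrite psumr_neq0 => [|p _]; last by rewrite mulr_ge0.
  case/hasP=> -[c0 c1] _ /= /andP[/eqP <-]; rewrite lt0r mulf_eq0 negb_or.
  by case/andP=> /andP[/supp0 h0 /supp1 h1] _; apply: factorizes_glue.
rewrite sum_preimage.
case: (boolP [forall e in T, _]) => [_|]; last first.
  rewrite negb_forall_in mulr0 => /existsP[e /andP[eT ne]].
  rewrite big1 // => -[c0 c1] /= /forall_inP/(_ e eT); rewrite ffunE /= => /eqP ce.
  apply/eqP; rewrite mulf_eq0; apply: contraR ne; rewrite negb_or => /andP[].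
  move=> /supp0[r0 _] /supp1[r1 _]; move: ce; case: ifP => eF1 ce.
    by have := r1 e eF1; rewrite ce => /andP[->].
  have := r0 e; rewrite inE eF1 (subsetP TF) // ce => /(_ isT)/andP[_].
  by rewrite ltnNge => /negbTE ->.
rewrite mulr1 -(cardsID F1 T) addnC exprD.
apply: le_trans (ler_pM _ _ (spr0 (T :\: F1) s _) (spr1 (T :&: F1) s _)).
- rewrite mulr_suml.
  under [X in _ <= X]eq_bigr => c0 _ do rewrite mulr_sumr.
  rewrite pair_big /= big_mkcond [X in _ <= X]big_mkcond /=.
  apply: ler_sum => -[c0 c1] _ /=; case: ifP => [|_]; last first.
    by case: ifP => // _; rewrite mulr_ge0.
  move=> /forall_inP h; rewrite ifT //; apply/andP; split; apply/forall_inP => e.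
    by rewrite inE => /andP[/negbTE eF1 eT]; have := h e eT; rewrite ffunE eF1.
  by rewrite inE => /andP[eT eF1]; have := h e eT; rewrite ffunE eF1.
- exact: sumr_ge0.
- exact: sumr_ge0.
- exact: setSD.
- exact: subsetIr.
Qed.

End Colouring.

(** * Concentration for random labels *)

Section Labels.
Variables (R : realType) (E : finType) (eps : R).
Hypothesis eps01 : 0 < eps <= 1 / 4.
Implicit Types (C T : {set E}) (w : {ffun E -> option bool}).

(* [Some b] commits an edge to half [b]; [None] leaves it free. *)
Definition label_pr (x : option bool) : R := if x is None then eps else (1 - eps) / 2.

Definition label_wt w : R := \prod_e label_pr (w e).

Lemma sum_option_bool (f : option bool -> R) :
  \sum_x f x = f None + f (Some false) + f (Some true).
Proof.
rewrite (bigD1 None) //= (bigD1 (Some false)) //= (bigD1 (Some true)) //= big1 ?addr0 ?addrA //.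
by case=> [[]|].
Qed.

Lemma label_pr_ge0 x : 0 <= label_pr x.
Proof. by case/andP: eps01; case: x => [b|] /=; lra. Qed.

Lemma label_wt_ge0 w : 0 <= label_wt w.
Proof. by apply: prodr_ge0 => e _; apply: label_pr_ge0. Qed.

Lemma expect_prod T (psi : E -> option bool -> R) :
  \sum_(w : {ffun E -> option bool}) label_wt w * \prod_(e in T) psi e (w e)
    = \prod_(e in T) \sum_x label_pr x * psi e x.
Proof.
pose phi e x := label_pr x * (if e \in T then psi e x else 1).
transitivity (\prod_e \sum_x phi e x); last first.
  rewrite [RHS]big_mkcond /=; apply: eq_bigr => e _; rewrite /phi; case: ifP => // _.
  by rewrite sum_option_bool /= !mulr1; field.
rewrite bigA_distr_bigA /=; apply: eq_bigr => w _.
by rewrite /label_wt [X in _ * X]big_mkcond -big_split.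
Qed.

Lemma sum_label_wt : \sum_w label_wt w = 1.
Proof.
have := expect_prod set0 (fun _ _ => 1); rewrite [RHS]big_set0 => <-.
by apply: eq_bigr => w _; rewrite big_set0 mulr1.
Qed.

Lemma label_wt_le1 (P : pred {ffun E -> option bool}) : \sum_(w | P w) label_wt w <= 1.
Proof.
rewrite -[leRHS]sum_label_wt [leRHS](bigID P) /= lerDl.
by apply: sumr_ge0 => w _; apply: label_wt_ge0.
Qed.

(** Chernoff's method: Markov's inequality for the exponential of the sum, whose mean factors over
    the edges by independence. *)
Lemma label_tail (a : option bool -> R) C m tau :
  \sum_x label_pr x * expR (a x) <= expR m ->
  \sum_(w : {ffun E -> option bool} | tau <= \sum_(e in C) a (w e)) label_wt w
    <= expR (m * #|C|%:R - tau).
Proof.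
move=> ham.
apply: (@le_trans _ _ (\sum_(w : {ffun E -> option bool})
    label_wt w * expR (\sum_(e in C) a (w e) - tau))).
  rewrite big_mkcond; apply: ler_sum => w _; case: ifP => [h|_].
    by rewrite ler_peMr ?label_wt_ge0 // -[X in X <= _]expR0 ler_expR subr_ge0.
  by rewrite mulr_ge0 ?label_wt_ge0 ?expR_ge0.
under eq_bigr => w _ do rewrite expRD mulrA expR_sum.
rewrite -mulr_suml (expect_prod C (fun _ x => expR (a x))) expRD ler_wpM2r ?expR_ge0 //.
rewrite prodr_const expRM_natr lerXn2r ?nnegrE ?expR_ge0 //.
by apply: sumr_ge0 => x _; rewrite mulr_ge0 ?label_pr_ge0 ?expR_ge0.
Qed.

Lemma expRN_le (x : R) : 0 <= x -> expR (- x) <= 1 - x + x ^+ 2.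
Proof.
move=> x0; rewrite expRN -[leLHS]mul1r ler_pdivrMr ?expR_gt0 //.
(* The product is [1 + x ^+ 3]. *)
apply: (@le_trans _ _ ((1 - x + x ^+ 2) * (1 + x))); first by nra.
by rewrite ler_wpM2l ?expR_ge1Dx //; nra.
Qed.

Lemma expR_le_quad (x : R) : 0 <= x <= 1 / 2 -> expR x <= 1 + x + 2 * x ^+ 2.
Proof.
move=> /andP[x0 x1]; have h : 0 < 1 - x by lra.
(* Multiplied by [1 - x], the right side becomes [1 + x ^+ 2 - 2 * x ^+ 3], at least 1 for
   [x <= 1 / 2]. *)
rewrite -(ler_pM2r h); apply: (@le_trans _ _ (expR x * expR (- x))).
  by rewrite ler_wpM2l ?expR_ge0 ?expR_ge1Dx.
by rewrite expRxMexpNx_1; nra.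
Qed.

(** The share of every cut guaranteed to a label: half of the mean [eps] for free edges, and the
    mean [(1 - eps) / 2] less [eps / 2] for either commitment. *)
Definition label_thr (x : option bool) : R :=
  if x is None then eps / 2 else (1 - 2 * eps) / 2.

Lemma sum_lab (x : option bool) (C : {set E}) (c : R) w :
  \sum_(e in C) (if w e == x then c else 0) = c * #|lab w C x|%:R.
Proof.
rewrite -big_mkcondr /= mulr_natr -sumr_const; apply: eq_bigl => e.
by rewrite inE.
Qed.

Lemma label_lower_tail C (x : option bool) :
  \sum_(w : {ffun E -> option bool} | #|lab w C x|%:R < label_thr x * #|C|%:R) label_wt w
    <= expR (- (eps ^+ 2 / 8) * #|C|%:R).
Proof.
have /andP[e0 e1] := eps01; have C0 : 0 <= #|C|%:R :> R by [].
case: x => [b|].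
  (* With this tilt the exponent per edge is [- (eps ^+ 2 + eps ^+ 3) / 8]. *)
  pose a y := if y == Some b then - (eps / 2) else 0.
  apply: (@le_trans _ _ (\sum_(w : {ffun E -> option bool}
                           | - (eps / 2) * (label_thr (Some b) * #|C|%:R)
                             <= \sum_(e in C) a (w e)) label_wt w)).
    rewrite big_mkcond [leRHS]big_mkcond; apply: ler_sum => w _.
    case: ifP => [h|_]; last by case: ifP; rewrite ?label_wt_ge0.
    by rewrite ifT // sum_lab; nra.
  have am : \sum_x label_pr x * expR (a x)
      <= expR (- ((1 - eps) / 2 * (eps / 2 - (eps / 2) ^+ 2))).
    apply: le_trans (expR_ge1Dx _).
    have hx : expR (- (eps / 2)) <= 1 - eps / 2 + (eps / 2) ^+ 2 by apply: expRN_le; lra.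
    have p0 : 0 <= (1 - eps) / 2 by lra.
    move: (ler_wpM2l p0 hx); rewrite sum_option_bool /a /label_pr.
    by case: (b) => /=; rewrite expR0; lra.
  apply: le_trans (label_tail _ _ am) _; rewrite ler_expR /label_thr.
  have : 0 <= eps ^+ 3 * #|C|%:R by rewrite mulr_ge0 // exprn_ge0 // ltW.
  by lra.
(* For free edges the exponent is [- eps / 16] per edge, weakened to the common bound. *)
pose a (y : option bool) := if y == None then - (1 / 4) else 0 : R.
apply: (@le_trans _ _ (\sum_(w : {ffun E -> option bool} | - (1 / 4) * (label_thr None * #|C|%:R)
                           <= \sum_(e in C) a (w e)) label_wt w)).
  rewrite big_mkcond [leRHS]big_mkcond; apply: ler_sum => w _.
  case: ifP => [h|_]; last by case: ifP; rewrite ?label_wt_ge0.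
  by rewrite ifT // sum_lab; nra.
have am : \sum_x label_pr x * expR (a x) <= expR (- (eps * (3 / 16))).
  apply: le_trans (expR_ge1Dx _).
  have hx : expR (- (1 / 4)) <= 1 - 1 / 4 + (1 / 4 : R) ^+ 2 by apply: expRN_le; lra.
  move: (ler_wpM2l (ltW e0) hx).
  by rewrite sum_option_bool /a /label_pr /= expR0; lra.
apply: le_trans (label_tail _ _ am) _; rewrite ler_expR /label_thr.
have : 0 <= eps * #|C|%:R * (1 / 2 - eps) by rewrite !mulr_ge0 //; lra.
by lra.
Qed.

Lemma label_balance_tail C (b : bool) (t : R) : 0 <= t <= 2 * #|C|%:R ->
  \sum_(w : {ffun E -> option bool}
       | t <= #|lab w C (Some b)|%:R - #|lab w C (Some (~~ b))|%:R) label_wt w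
    <= expR (- (t ^+ 2 / (8 * #|C|%:R))).
Proof.
move=> /andP[t0 tC]; have /andP[e0 e1] := eps01.
have [C0|C0] := posnP #|C|.
  by rewrite C0 mulr0 invr0 mulr0 oppr0 expR0 label_wt_le1.
have Cp : 0 < #|C|%:R :> R by rewrite ltr0n.
(* The minimizer of the exponent [2 * l ^+ 2 * #|C| - l * t]; the assumed upper bound on [t] gives
   [l <= 1 / 2], as [expR_le_quad] requires. *)
pose l := t / (4 * #|C|%:R).
have l0 : 0 <= l by rewrite divr_ge0 // mulr_ge0.
have l1 : l <= 1 / 2 by rewrite ler_pdivrMr; nra.
have lC : l * (4 * #|C|%:R) = t by rewrite divfK // mulf_neq0 // lt0r_neq0.
pose a y := (if y == Some b then l else 0) + (if y == Some (~~ b) then - l else 0).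
apply: (@le_trans _ _ (\sum_(w : {ffun E -> option bool}
                         | l * t <= \sum_(e in C) a (w e)) label_wt w)).
  rewrite big_mkcond [leRHS]big_mkcond; apply: ler_sum => w _.
  case: ifP => [h|_]; last by case: ifP; rewrite ?label_wt_ge0.
  by rewrite ifT // big_split !sum_lab /= mulNr -mulrBr ler_wpM2l.
have am : \sum_x label_pr x * expR (a x) <= expR (2 * l ^+ 2).
  apply: le_trans (expR_ge1Dx _).
  have := @expRN_le l l0; have := @expR_le_quad l; rewrite l0 l1 => /(_ isT).
  by rewrite sum_option_bool /a /label_pr; case: (b) => /=; rewrite ?addr0 ?add0r expR0; nra.
apply: le_trans (label_tail _ _ am) _; rewrite ler_expR.
have -> : t ^+ 2 / (8 * #|C|%:R) = 2 * l ^+ 2 * #|C|%:R.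
  by rewrite -lC; field; rewrite lt0r_neq0.
by rewrite -lC; nra.
Qed.

End Labels.

(** * Union bounds over events and over vertex sets *)

Lemma sum_exists_le (R : realType) (I J : finType) (f : J -> R) (P : pred I) (Q : I -> pred J) :
  (forall j, 0 <= f j) ->
  \sum_(j | [exists i, P i && Q i j]) f j <= \sum_(i | P i) \sum_(j | Q i j) f j.
Proof.
move=> f0; rewrite (exchange_big_dep xpredT) //= big_mkcond /=.
apply: ler_sum => j _; case: ifP => [/existsP[i PQi]|_]; last exact: sumr_ge0.
by rewrite (bigD1 i) //= lerDl sumr_ge0.
Qed.

Lemma sum_expr_card (R : realType) (V : finType) (u : R) :
  \sum_(Z : {set V}) u ^+ #|Z| = (1 + u) ^+ #|V|.
Proof.
rewrite -[RHS](prodr_const V) addrC bigA_distr; apply: eq_bigr => Z _.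
by rewrite -big_mkcond prodr_const.
Qed.

(** The sum is [(1 + u) ^+ #|V| - 1], and [(1 + u) ^+ N <= expR (N u) <= 1 / (1 - N u)]. Failure
    probabilities [u ^+ #|Z|] thus outweigh the number of sets [Z]. *)
Lemma sum_expr_card_le (R : realType) (V : finType) (u : R) :
  0 <= u -> #|V|%:R * u <= 1 / 2 ->
  \sum_(Z : {set V} | Z != set0) u ^+ #|Z| <= 2 * #|V|%:R * u.
Proof.
move=> u0 small; have Nu0 : 0 <= #|V|%:R * u by rewrite mulr_ge0.
have := sum_expr_card V u; rewrite (bigD1 set0) //= cards0 expr0.
have : (1 + u) ^+ #|V| <= 1 + 2 * (#|V|%:R * u).
  apply: (@le_trans _ _ (expR (#|V|%:R * u))).
    by rewrite expRM_natl lerXn2r ?nnegrE ?expR_ge0 ?expR_ge1Dx //; lra.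
  have h : 0 < 1 - #|V|%:R * u by lra.
  rewrite -(ler_pM2r h); apply: (@le_trans _ _ (expR (#|V|%:R * u) * expR (- (#|V|%:R * u)))).
    by rewrite ler_wpM2l ?expR_ge0 ?expR_ge1Dx.
  by rewrite expRxMexpNx_1; nra.
lra.
Qed.

(** * The halving step *)

Section Step.
Variables (E V : finType) (src tgt : E -> V) (A : {set V}).
Hypotheses (srcA : forall e, src e \in A) (tgtA : forall e, tgt e \notin A).
Variables (R : realType) (d : nat).
Implicit Types (F : {set E}) (Z : {set V}) (v : V) (w : {ffun E -> option bool}).

Notation cut := (edge_cut src tgt).
Notation deg := (degree src tgt).

Definition expands F (g : R) :=
  forall Z, (#|Z|.*2 <= #|V|)%N -> g * #|Z|%:R <= (cut F Z)%:R.

Definition crossing F Z : {set E} := [set e in F | (src e \in Z) != (tgt e \in Z)].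

Lemma card_crossing F Z : #|crossing F Z| = cut F Z.
Proof.
rewrite -sum1_card /edge_cut [RHS](bigID (fun e => (src e \in Z) != (tgt e \in Z))) /=.
rewrite [X in (_ = _ + X)%N]big1 ?addn0 => [|e /andP[_ /negbTE ->] //].
by apply: eq_big => [e|e]; rewrite inE // => /andP[_ ->].
Qed.

Lemma card_lab_crossing F Z w x : #|lab w (crossing F Z) x| = cut (lab w F x) Z.
Proof.
by rewrite -card_crossing; apply: eq_card => e; rewrite !inE andbAC.
Qed.

(** These are the demands of the flow argument: degree differences small enough to be corrected by
    the free edges, and enough committed edges in every cut for both halves to expand. *)
Definition typical (eps g : R) F w : Prop :=
  (forall v b, (deg (lab w F (Some b)) v)%:R
     < (deg (lab w F (Some (~~ b))) v)%:R + eps * g / 4) /\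
  (forall Z x, (#|Z|.*2 <= #|V|)%N ->
     label_thr eps x * (cut F Z)%:R <= (cut (lab w F x) Z)%:R).

(** The [2 #|V|] imbalances cost [u] each. Each of the three labels fails on [Z] with probability at
    most [u ^+ #|Z|], because [Z] has at least [g #|Z|] cut edges; this costs [6 #|V| u] in all. The
    total [8 #|V| u] is at most [eps / 2]. *)
Lemma typical_likely (eps g : R) D F :
  0 < eps <= 1 / 4 -> (1 < #|V|)%N -> (forall v, deg F v = D) -> expands F g ->
  0 < g -> D%:R <= 16 * g -> 16 * #|V|%:R * expR (- (eps ^+ 2 * g / 2048)) <= eps ->
  exists2 good : pred {ffun E -> option bool},
    1 - eps / 2 <= \sum_(w | good w) label_wt eps w &
    forall w, good w -> typical eps g F w.
Proof.
move=> eps01 V2 regF expF g0 Dg; set u := expR _ => small.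
have /andP[e0 e1] := eps01.
have u0 : 0 <= u by exact: expR_ge0.
pose unbal (vb : V * bool) w := eps * g / 4 <=
  #|lab w (crossing F [set vb.1]) (Some vb.2)|%:R
    - #|lab w (crossing F [set vb.1]) (Some (~~ vb.2))|%:R.
pose sparse (Zx : {set V} * option bool) w :=
  #|lab w (crossing F Zx.1) Zx.2|%:R < label_thr eps Zx.2 * #|crossing F Zx.1|%:R.
(* The empty set must stay out of the union bound, where its term would be [u ^+ 0 = 1]. *)
pose proper (Zx : {set V} * option bool) := (Zx.1 != set0) && (#|Zx.1|.*2 <= #|V|)%N.
pose bad1 w := [exists vb, true && unbal vb w].
pose bad2 w := [exists Zx, proper Zx && sparse Zx w].
have gD : g <= D%:R.
  have /card_gt0P[v _] : (0 < #|V|)%N by lia.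
  by have := expF [set v]; rewrite cards1 mulr1 -/(deg F v) regF; apply; lia.
(* With [t = eps g / 4] and [D <= 16 g], the exponent [t ^+ 2 / (8 D)] is at least
   [eps ^+ 2 g / 2048]. *)
have P1 : \sum_(w | bad1 w) label_wt eps w <= 2 * #|V|%:R * u.
  apply: le_trans (sum_exists_le _ _ (label_wt_ge0 eps01)) _.
  apply: (@le_trans _ _ (\sum_(vb : V * bool) u)); last first.
    by rewrite sumr_const card_prod card_bool -[leLHS]mulr_natr natrM; lra.
  apply: ler_sum => -[v b] _; apply: le_trans (label_balance_tail eps01 _ _) _.
    rewrite card_crossing -/(deg F v) regF; nra.
  rewrite card_crossing -/(deg F v) regF ler_expR lerN2.
  rewrite ler_pdivlMr ?ler_pdivrMr; nra.
have P2 : \sum_(w | bad2 w) label_wt eps w <= 3 * (2 * #|V|%:R * u).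
  apply: le_trans (sum_exists_le _ _ (label_wt_ge0 eps01)) _.
  apply: (@le_trans _ _ (3 * \sum_(Z : {set V} | Z != set0) u ^+ #|Z|)); last first.
    by rewrite ler_wpM2l // sum_expr_card_le //; lra.
  rewrite mulr_sumr (eq_bigr (fun Z => \sum_(x : option bool) u ^+ #|Z|)); last first.
    by move=> Z _; rewrite sum_option_bool; ring.
  rewrite pair_big /= [leRHS]big_mkcond [leLHS]big_mkcond /=; apply: ler_sum => -[Z x] _ /=.
  rewrite /proper andbT /=; case: eqP => //= _; case: ifP => [Z2|_]; last exact: exprn_ge0.
  have gZ := expF Z Z2; rewrite -expRM_natr /sparse /=.
  have tail : expR (- (eps ^+ 2 / 8) * #|crossing F Z|%:R)
      <= expR (- (eps ^+ 2 * g / 2048) * #|Z|%:R).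
    rewrite ler_expR card_crossing; have ee0 : 0 <= eps ^+ 2 by rewrite exprn_ge0 // ltW.
    have := ler_wpM2l ee0 gZ; have : 0 <= eps ^+ 2 * (cut F Z)%:R by rewrite mulr_ge0.
    by lra.
  exact: le_trans (label_lower_tail eps01 _ _) tail.
exists (fun w => ~~ (bad1 w || bad2 w)).
  have := sum_label_wt E eps; rewrite (bigID (fun w => bad1 w || bad2 w)) /= => tot.
  have : \sum_(w | bad1 w || bad2 w) label_wt eps w
      <= \sum_(w | bad1 w) label_wt eps w + \sum_(w | bad2 w) label_wt eps w.
    rewrite big_mkcond (big_mkcond bad1) (big_mkcond bad2) -big_split /=.
    apply: ler_sum => w _; have := label_wt_ge0 eps01 w.
    by case: (bad1 w); case: (bad2 w) => /=; lra.
  lra.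
move=> w; rewrite negb_or => /andP[/existsPn h1 /existsPn h2]; split=> [v b|Z x Z2].
  by have := h1 (v, b); rewrite /unbal /= !card_lab_crossing -ltNge; lra.
have [->|Z0] := eqVneq Z set0.
  have c0 G : cut G set0 = 0%N by rewrite /edge_cut big1 // => e _; rewrite !inE.
  by rewrite !c0 mulr0.
by have := h2 (Z, x); rewrite /proper /sparse /= Z0 Z2 /= -leNgt card_lab_crossing card_crossing.
Qed.

(** Each half contains all edges committed to it, and these alone carry the expansion, however the
    flow distributes the free edges. *)
Lemma typical_split (eps g : R) D F w :
  0 < eps <= 1 / 4 -> 4 <= eps * g -> (forall v, deg F v = D) -> expands F g ->
  typical eps g F w ->
  exists F1 : {set E},
    [/\ F1 \subset F, lab w F (Some true) \subset F1, [disjoint lab w F (Some false) & F1],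
      forall v, deg F1 v = D./2 /\ deg (F :\: F1) v = (D - D./2)%N &
      expands F1 (g * (1 - 2 * eps) / 2) /\ expands (F :\: F1) (g * (1 - 2 * eps) / 2)].
Proof.
move=> /andP[e0 e1] eg regF expF [balanced dense].
(* An integer above [eps g / 4], the bound on the imbalance. By [4 <= eps g] it is at most
   [eps g / 2], the expansion guaranteed to the free edges. *)
pose m := (Num.truncn (eps * g / 4)).+1.
have mle : m%:R <= eps * g / 2.
  have t0 : 0 <= eps * g / 4 by lra.
  have /andP[tr _] := truncn_itv t0.
  by rewrite /m -[leLHS]natr1; lra.
have bal v b : (deg (lab w F (Some b)) v < deg (lab w F (Some (~~ b))) v + m)%N.
  rewrite -(ltr_nat R) natrD; apply: lt_le_trans (balanced v b) _.
  by rewrite lerD2l ltW // truncnS_gt.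
have flex Z : (m * minn #|Z| #|~: Z| <= cut (lab w F None) Z)%N.
  have half (Y : {set V}) : (#|Y|.*2 <= #|V|)%N -> (m * #|Y| <= cut (lab w F None) Y)%N.
    move=> Y2; rewrite -(ler_nat R) natrM; apply: le_trans (dense Y None Y2).
    apply: (@le_trans _ _ (eps * g / 2 * #|Y|%:R)); first by rewrite ler_wpM2r.
    have -> : eps * g / 2 * #|Y|%:R = label_thr eps None * (g * #|Y|%:R).
      by rewrite /label_thr; field.
    by rewrite ler_wpM2l /label_thr ?expF //; lra.
  have := cardsC Z; have [Z2|Z2] := leqP #|Z|.*2 #|V| => cZ.
    by apply: leq_trans (half Z Z2); rewrite leq_mul2l geq_minl orbT.
  rewrite -cutC; apply: leq_trans (half (~: Z) _); last by lia.
  by rewrite leq_mul2l geq_minr orbT.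
have [F1 [F1F regF1 L1F1 L0F1]] :=
  @split_regular _ _ _ _ A srcA tgtA F D w m regF (bal^~ true) (bal^~ false) flex.
have sparse (G : {set E}) b : lab w F (Some b) \subset G -> expands G (g * (1 - 2 * eps) / 2).
  move=> LG Z Z2; apply: (@le_trans _ _ (cut (lab w F (Some b)) Z)%:R); last first.
    by rewrite ler_nat cut_sub.
  apply: le_trans (dense Z (Some b) Z2).
  have -> : g * (1 - 2 * eps) / 2 * #|Z|%:R = label_thr eps (Some b) * (g * #|Z|%:R).
    by rewrite /label_thr; field.
  by rewrite ler_wpM2l /label_thr ?expF //; lra.
exists F1; split=> // [v|].
  by split=> //; have := regF v; rewrite /degree (cutD _ _ _ F1F) -/(deg _ _) regF1; lia.
split; first exact: sparse L1F1.
apply: (sparse _ false); rewrite subsetD L0F1 andbT.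
by apply/subsetP => e; rewrite inE => /andP[].
Qed.

(* One of the two factors [1 + eps] pays for conditioning on a typical labelling. *)
Lemma random_factorization_step (eps g q : R) D F o :
  0 < eps <= 1 / 4 -> (1 < #|V|)%N -> 0 <= q -> 4 <= eps * g -> D%:R <= 16 * g ->
  16 * #|V|%:R * expR (- (eps ^+ 2 * g / 2048)) <= eps ->
  (forall v, deg F v = D) -> expands F g -> (o + D <= d.+1)%N ->
  (forall F' D' o', D' = D./2 \/ D' = (D - D./2)%N -> (forall v, deg F' v = D') ->
     expands F' (g * (1 - 2 * eps) / 2) -> (o' + D' <= d.+1)%N ->
     random_factorization src tgt F' o' D' (fun (T : {set E}) (_ : E -> 'I_d.+1) => q ^+ #|T|)) ->
  random_factorization src tgt F o D
    (fun (T : {set E}) (_ : E -> 'I_d.+1) => (q * (1 + eps) ^+ 2 / 2) ^+ #|T|).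
Proof.
move=> eps01 V2 q0 eg Dg small regF expF oD IH; have /andP[e0 e1] := eps01.
have g0 : 0 < g by rewrite -(pmulr_rgt0 _ e0); lra.
have [good likely goodP] := typical_likely eps01 V2 regF expF g0 Dg small.
set p := \sum_(w | good w) _ in likely.
have p0 : 0 < p by lra.
pose wt w := if good w then label_wt eps w / p else 0.
have wt0 w : 0 <= wt w by rewrite /wt; case: ifP => // _; rewrite divr_ge0 ?label_wt_ge0 // ltW.
have wt1 : \sum_w wt w = 1 by rewrite -big_mkcond -mulr_suml divff // lt0r_neq0.
(* Indicates that the label of [e] allows the half that owns the colour [s e]; its mean is
   [(1 + eps) / 2]. *)
pose psi (s : E -> 'I_d.+1) e (x : option bool) : R :=
  ((x == None) || (x == Some (o + (D - D./2) <= s e)%N))%:R.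
pose B w (T : {set E}) s := q ^+ #|T| * \prod_(e in T) psi s e (w e).
have [w wtw|mu [mu0 mu1 supp spr]] :=
  @random_factorization_mix E V src tgt R d _ wt F o D B wt0 wt1.
  have gw : good w by move: wtw; rewrite /wt; case: ifP => //; rewrite eqxx.
  have [F1 [F1F L1F1 L0F1 regF1 [expF1 expF0]]] := typical_split eps01 eg regF expF (goodP w gw).
  have := @random_factorization_glue E V src tgt R d F F1 o (D - D./2) D./2 q F1F q0.
  have -> : (D - D./2 + D./2)%N = D by clear; lia.
  case=> [||nu [nu0 nu1 nsupp nspr]].
  - apply: IH expF0 _; [by right|by move=> v; case: (regF1 v)|].
    by clear -oD; lia.
  - apply: IH expF1 _; [by left|by move=> v; case: (regF1 v)|].
    by clear -oD; lia.
  exists nu; split=> // T s TF; apply: le_trans (nspr T s TF) _; rewrite /B.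
  rewrite ler_wpM2l ?exprn_ge0 //.
  have psi0 e : 0 <= psi s e (w e) by rewrite /psi.
  case: (boolP [forall e in T, _]) => [/forall_inP h|_]; last exact: prodr_ge0.
  rewrite big1 // => e eT; rewrite /psi -(eqP (h e eT)).
  case we: (w e) => [b|] //=; suff -> : (e \in F1) = b by rewrite eqxx.
  have eF := subsetP TF e eT; case: b we => we.
    by apply: (subsetP L1F1); rewrite inE eF we eqxx.
  by apply: (disjointFr L0F1); rewrite inE eF we eqxx.
exists mu; split=> // T s TF.
(* Without an edge in [T] there is no factor [1 + eps] to pay for [p^-1]; the probability is then
   1. *)
have [->|T0] := eqVneq T set0.
  rewrite cards0 expr0 -mu1 [leRHS](bigID (agrees set0 s)) /= lerDl.
  exact: sumr_ge0.
apply: le_trans (spr T s TF) _; rewrite /B.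
have : \sum_w wt w * (q ^+ #|T| * \prod_(e in T) psi s e (w e))
    <= q ^+ #|T| / p * ((1 + eps) / 2) ^+ #|T|.
  have -> : ((1 + eps) / 2) ^+ #|T| = \prod_(e in T) \sum_x label_pr eps x * psi s e x.
    rewrite -prodr_const; apply: eq_bigr => e _; rewrite sum_option_bool /psi /=.
    by case: (_ <= _)%N => /=; field.
  rewrite -expect_prod mulr_sumr; apply: ler_sum => w _; rewrite /wt.
  have pr0 : 0 <= \prod_(e in T) psi s e (w e) by apply: prodr_ge0 => e _; rewrite /psi.
  case: ifP => _; last first.
    rewrite mul0r !mulr_ge0 ?exprn_ge0 ?invr_ge0 ?label_wt_ge0 // ltW //.
  by rewrite le_eqVlt; apply/orP; left; apply/eqP; ring.
move/le_trans; apply.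
(* Here [p >= 1 - eps / 2], and [(1 - eps / 2) (1 + eps) >= 1]. *)
have : p^-1 <= (1 + eps) ^+ #|T|.
  apply: (@le_trans _ _ (1 + eps)).
    by rewrite -[leLHS]mul1r ler_pdivrMr //; nra.
  by rewrite ler_eXnr // -?card_gt0 ?card_gt0 //; lra.
move=> hp; rewrite mulrAC.
have -> : q * (1 + eps) ^+ 2 / 2 = q * ((1 + eps) / 2) * (1 + eps) by field.
by rewrite [leRHS]exprMn -[X in X / p <= _]exprMn ler_wpM2l // exprn_ge0 // mulr_ge0 //; lra.
Qed.

End Step.

(** * Recursion *)

(** By Bernoulli's inequality [K (9/8)^l >= K + l]; the factor [expR (- K)] pays for [N], and
    [expR (- 1) <= 3 / 4] gives the decay in [l]. *)
Lemma label_error_small (R : realType) (K : R) (N l : nat) :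
  512 * N%:R <= expR K -> 8 <= K ->
  16 * N%:R * expR (- (K * (9 / 8) ^+ l)) <= 1 / 32 * (3 / 4) ^+ l.
Proof.
move=> NK K8.
have bern : 1 + l%:R / 8 <= (9 / 8 : R) ^+ l.
  elim: (l) => [|m IH]; first by rewrite mul0r addr0 expr0.
  by rewrite exprS -[m.+1%:R]natr1; have : 0 <= m%:R :> R by []; nra.
have e2 : expR (- 1) <= 3 / 4 :> R.
  rewrite expRN -[leLHS]mul1r ler_pdivrMr ?expR_gt0 //.
  by have := expR_ge1Dx (1 : R); lra.
have l0 : 0 <= l%:R :> R by [].
apply: (@le_trans _ _ (16 * N%:R * (expR (- K) * expR (- 1) ^+ l))).
  by rewrite ler_wpM2l ?mulr_ge0 // -expRM_natr -expRD ler_expR; nra.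
have NK' : N%:R * expR (- K) <= 1 / 512.
  by rewrite expRN ler_pdivrMr ?expR_gt0 //; lra.
have p0 : 0 <= (3 / 4 : R) ^+ l by rewrite exprn_ge0 //; lra.
have p1 : expR (- 1) ^+ l <= (3 / 4 : R) ^+ l by rewrite lerXn2r ?nnegrE ?expR_ge0 //; lra.
have q0 : 0 <= N%:R * expR (- K) by rewrite mulr_ge0 ?expR_ge0.
have r0 : 0 <= expR (- 1 : R) ^+ l by rewrite exprn_ge0 ?expR_ge0.
have := ler_pM q0 r0 NK' p1; lra.
Qed.

Section Levels.
Variables (E V : finType) (src tgt : E -> V) (A : {set V}).
Hypotheses (srcA : forall e, src e \in A) (tgtA : forall e, tgt e \notin A).
Variables (R : realType) (d : nat).
Implicit Types (F : {set E}).

Notation deg := (degree src tgt).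
Notation expands := (@expands E V src tgt R).

Definition spread_bound (q : R) (T : {set E}) (_ : E -> 'I_d.+1) : R := q ^+ #|T|.

Lemma expands_le F (g g' : R) : g' <= g -> expands F g -> expands F g'.
Proof.
by move=> gg expF Z Z2; apply: le_trans (expF Z Z2); rewrite ler_wpM2r.
Qed.

Lemma random_factorization_le F o D (B B' : {set E} -> (E -> 'I_d.+1) -> R) :
  (forall T s, B T s <= B' T s) ->
  random_factorization src tgt F o D B -> random_factorization src tgt F o D B'.
Proof.
move=> BB [mu [mu0 mu1 supp spr]]; exists mu; split=> // T s TF.
exact: le_trans (spr T s TF) (BB T s).
Qed.

(* The bounds [k 2^l <= D <= (k + 1) 2^l] survive rounding when [D] is halved.
   The error [eps = (3/4)^l / 32] at level [l] is summable, while [eps^2 D] still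
   grows like [(9/8)^l], which is what the concentration bounds need; the factors
   [2 - (3/4)^l] absorb the accumulated errors. The constant
   [2048 * 64 * 128 = 2048 * 8 * 32^2] makes [K (9/8)^l] a lower bound for their
   exponent [eps^2 g / 2048]. *)
Lemma random_factorization_levels (K : R) (k l D o : nat) F :
  (1 < #|V|)%N -> 512 * #|V|%:R <= expR K -> 8 <= K -> 2048 * (64 * (128 * K)) <= k%:R ->
  (k * 2 ^ l <= D <= k.+1 * 2 ^ l)%N -> (forall v, deg F v = D) ->
  expands F (1 / 8 * (2 - (3 / 4) ^+ l) * (k%:R * 2 ^+ l)) -> (o + D <= d.+1)%N ->
  random_factorization src tgt F o D (spread_bound ((2 - (3 / 4) ^+ l) / 2 ^+ l)).
Proof.
move=> V2 NK K8 Kk; elim: l D o F => [|l IH] D o F kD regF expF oD.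
  apply: random_factorization_le (random_factorization_koenig srcA tgtA R regF oD) => T s.
  by rewrite /spread_bound !expr0 divr1 (_ : 2 - 1 = 1 :> R) ?expr1n //; lra.
set x : R := (3 / 4) ^+ l; have x0 : 0 <= x by rewrite exprn_ge0 //; lra.
have x1 : x <= 1 by rewrite exprn_ile1 //; lra.
set y : R := 2 ^+ l; have y0 : 0 < y by rewrite exprn_gt0.
pose eps : R := 1 / 32 * (3 / 4) ^+ l.+1.
pose g : R := 1 / 8 * (2 - (3 / 4) ^+ l.+1) * (k%:R * 2 ^+ l.+1).
have epsx : eps = 3 / 128 * x by rewrite /eps exprS -/x; field.
have gx : g = 1 / 4 * (2 - 3 / 4 * x) * (k%:R * y) by rewrite /g !exprS -/x -/y; field.
have xpos : 0 < x by rewrite exprn_gt0 //; lra.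
have k1 : 1 <= k%:R :> R by apply: le_trans Kk; lra.
have k0 : 0 < k%:R :> R by lra.
have ky0 : 0 < k%:R * y by rewrite mulr_gt0.
have eeg : 2048 * (K * (9 / 8) ^+ l.+1) <= eps ^+ 2 * g.
  have -> : (9 / 8 : R) ^+ l.+1 = ((3 / 4) ^+ l.+1) ^+ 2 * 2 ^+ l.+1.
    by rewrite -exprM mulnC exprM -exprMn; congr (_ ^+ _); field.
  rewrite gx epsx !exprS -/x -/y expr0 mulr1.
  set p := x * x * y; have p0 : 0 <= p by rewrite !mulr_ge0 // ltW.
  have Kp := ler_wpM2r p0 Kk.
  have k1' : 0 <= k%:R * p * (1 - x) by rewrite mulr_ge0 ?subr_ge0 // mulr_ge0 // ltW.
  have kp : 0 <= k%:R * p by rewrite mulr_ge0 // ltW.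
  rewrite /p in Kp k1' kp; lra.
have nine : 1 <= (9 / 8 : R) ^+ l.+1 by rewrite exprn_ege1 //; lra.
(* The loss [(1 + eps) ^+ 2] with [eps = 3 x / 128] is covered as [2 - x] grows to [2 - 3 x / 4]. *)
apply: (@random_factorization_le _ _ _ (fun T _ => ((2 - x) / y * (1 + eps) ^+ 2 / 2) ^+ #|T|)).
  move=> T s; rewrite /spread_bound lerXn2r ?nnegrE //.
  - by rewrite !mulr_ge0 ?invr_ge0 ?exprn_ge0 ?(ltW y0) //; lra.
  - by rewrite divr_ge0 ?exprn_ge0 // exprS -/x; lra.
  rewrite !exprS -/x -/y expr0 mulr1 epsx.
  rewrite [leRHS](_ : _ = (2 - 3 / 4 * x) * (2^-1 * y^-1)); last by rewrite invfM.
  rewrite [leLHS](_ : _ = ((2 - x) * ((1 + 3 / 128 * x) * (1 + 3 / 128 * x)))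
    * (2^-1 * y^-1)); last by ring.
  rewrite ler_wpM2r ?mulr_ge0 ?invr_ge0 ?(ltW y0) //.
  have := mulr_ge0 x0 x0; have : 0 <= x * (x * x) by rewrite !mulr_ge0.
  by have := ler_wpM2l x0 x1; lra.
apply: (@random_factorization_step E V src tgt A srcA tgtA R d eps g) => //.
- by rewrite epsx; apply/andP; split; lra.
- by rewrite divr_ge0 ?(ltW y0) //; lra.
- have e1 : eps <= 1 by lra.
  have g0 : 0 <= g by rewrite gx !mulr_ge0 // ?(ltW k0) ?(ltW y0) //; lra.
  have e0 : 0 <= eps by lra.
  have : eps ^+ 2 * g <= eps * g by rewrite expr2 ler_wpM2r // ler_piMl //; lra.
  have := ler_wpM2l (le_trans (ler0n _ 8) K8) nine; lra.
- apply: (@le_trans _ _ (k.+1 * 2 ^ l.+1)%:R); first by rewrite ler_nat; case/andP: kD.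
  rewrite natrM natrX gx exprS -/y -[k.+1%:R]natr1.
  have : 0 <= (k%:R - 1) * y by rewrite mulr_ge0 ?subr_ge0 // ltW.
  have : 0 <= (1 - x) * (k%:R * y) by rewrite mulr_ge0 ?subr_ge0 // ltW.
  by lra.
- apply: le_trans (label_error_small l.+1 NK K8).
  by rewrite ler_wpM2l ?mulr_ge0 // ler_expR; lra.
move=> F' D' o' D'E regF' expF' oD'.
apply: IH => //.
  by clear -kD D'E; move: kD; rewrite !expnS; case: D'E; lia.
(* The same slack pays for the expansion: [(2 - 3 x / 4) (1 - 2 eps) >= 2 - x]. *)
apply: expands_le expF'; rewrite gx epsx -/x -/y.
rewrite [leRHS](_ : _ = 1 / 8 * (2 - 3 / 4 * x) * (1 - 2 * (3 / 128 * x)) * (k%:R * y));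
  last by field.
rewrite ler_wpM2r ?(ltW ky0) //.
by have := mulr_ge0 x0 x0; lra.
Qed.

End Levels.

(** * Spread factorizations of expanders of linear degree *)

Definition spread_const (R : realType) : R := 6 * (2048 * (64 * (128 * 16)) + 2).

Lemma ln_ge_half (R : realType) (n : nat) : (1 < n)%N -> 1 / 2 <= ln n%:R :> R.
Proof.
move=> n1; have n0 : 0 < n%:R :> R by rewrite ltr0n; lia.
rewrite -ler_expR lnK ?posrE //; apply: (@le_trans _ _ 2); last by rewrite ler_nat.
rewrite -[leLHS]invrK -expRN invf_ple ?posrE ?expR_gt0 //.
by have := expR_ge1Dx (- (1 / 2) : R); lra.
Qed.

Lemma spread_const_gt0 (R : realType) : 0 < spread_const R.
Proof. rewrite /spread_const; lra. Qed.

Section Expanding.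
Variables (E V : finType) (src tgt : E -> V) (A : {set V}).
Hypotheses (srcA : forall e, src e \in A) (tgtA : forall e, tgt e \notin A).
Variables (R : realType) (d : nat).

Lemma random_factorization_expander (n D : nat) (F : {set E}) :
  (1 < n)%N -> #|V| = (2 * n)%N -> (2 * n <= 3 * D)%N -> (D <= d.+1)%N ->
  (forall v, degree src tgt F v = D) -> expands src tgt F (D%:R / 4 : R) ->
  random_factorization src tgt F 0 D
    (@spread_bound E R d (spread_const R * ln n%:R / n%:R)).
Proof.
move=> n1 Vn nD Dd regF expF.
have n0 : 0 < n%:R :> R by rewrite ltr0n; clear -n1; lia.
(* [M] is the degree at which the recursion stops, for [K = 16 L]. Rounding it up to [k0] costs at
   most [1 <= 2 L]. The factor 6 arises from [2 / 2 ^+ l <= 4 k0 / D <= 6 k0 / n]. *)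
have [C [L [M [CE C0 LE L2 [ME MC]]]]] : exists C L M : R, [/\ C = spread_const R, 0 < C,
    L = ln n%:R, 1 / 2 <= L & M = 2048 * (64 * (128 * (16 * L))) /\ 6 * (M + 2 * L) <= C * L].
  exists (spread_const R), (ln n%:R), (2048 * (64 * (128 * (16 * ln n%:R)))).
  split; [by []|exact: spread_const_gt0|by []|exact: ln_ge_half|split; first by []].
  by rewrite /spread_const; lra.
have M0 : 0 <= M by rewrite ME; lra.
rewrite -CE -LE; have [k0 [k0_gt0 Mk0 k0M]] : exists k0 : nat,
    [/\ (0 < k0)%N, M <= k0%:R & 6 * k0%:R <= C * L].
  have /andP[tM _] := truncn_itv M0.
  exists (Num.truncn M).+1; split; [by []|by rewrite ltW // truncnS_gt|].
  apply: le_trans MC; rewrite ler_pM2l ?ltr0n // -[leLHS]natr1.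
  by lra.
have nDR : 2 * n%:R <= 3 * D%:R :> R by rewrite -!natrM ler_nat.
(* If [D < k0], then [n <= 3 D / 2 <= 6 k0 <= C L], so the claimed bound is at least 1 and any
   factorization works. *)
have [k0D|Dk0] := leqP k0 D; last first.
  apply: random_factorization_le (random_factorization_koenig srcA tgtA R regF _) => // T s.
  rewrite /spread_bound; apply: exprn_ege1; rewrite ler_pdivlMr // mul1r.
  have : D%:R <= k0%:R :> R by rewrite ler_nat ltnW.
  by lra.
(* The largest number of halvings that keeps the degree at least [k0]; hence
   [D <= k0 * 2 ^ l.+1]. *)
pose l := trunc_log 2 (D %/ k0); pose k := (D %/ 2 ^ l)%N.
have Dk0 : (0 < D %/ k0)%N by rewrite divn_gt0.
have /andP[lo hi] := trunc_log_bounds (isT : 1 < 2)%N Dk0.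
have k0k : (k0 <= k)%N by rewrite leq_divRL ?expn_gt0 // mulnC -leq_divRL.
have kD : (k * 2 ^ l <= D <= k.+1 * 2 ^ l)%N.
  by rewrite leq_trunc_div /= ltnW // ltn_ceil ?expn_gt0.
have Dhi : (D <= k0 * 2 ^ l.+1)%N by rewrite ltnW // mulnC -ltn_divLR.
set x : R := (3 / 4) ^+ l; have x0 : 0 <= x by rewrite exprn_ge0 //; lra.
have x1 : x <= 1 by rewrite exprn_ile1 //; lra.
have y0 : 0 < 2 ^+ l :> R by rewrite exprn_gt0.
apply: (@random_factorization_le _ _ _ _ _ _ _ _ _ (spread_bound ((2 - x) / 2 ^+ l))).
  move=> T s; rewrite /spread_bound lerXn2r ?nnegrE //.
  - by rewrite divr_ge0 ?(ltW y0) //; lra.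
  - by rewrite !mulr_ge0 ?invr_ge0 ?(ltW n0) ?(ltW C0) //; lra.
  apply: (@le_trans _ _ (2 / 2 ^+ l)); first by rewrite ler_wpM2r ?invr_ge0 ?(ltW y0) //; lra.
  rewrite ler_pdivlMr // mulrAC ler_pdivrMr //.
  apply: (@le_trans _ _ (6 * k0%:R * 2 ^+ l)); last by rewrite ler_wpM2r ?(ltW y0).
  have : D%:R <= k0%:R * (2 * 2 ^+ l) :> R by rewrite -exprS -natrX -natrM ler_nat.
  by lra.
have k0kR : k0%:R <= k%:R :> R by rewrite ler_nat.
apply: (@random_factorization_levels E V src tgt A srcA tgtA R d (16 * L) k) => //.
- by rewrite Vn; clear -n1; lia.
(* The claim is [2 ^+ 10 * n <= n ^+ 16]. The factor 16 in [K] also gives [8 <= K], as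
   [L >= 1 / 2]. *)
- rewrite LE Vn expRM_natl lnK ?posrE // natrM.
  apply: (@le_trans _ _ (n%:R ^+ 11)); last by rewrite ler_eXn2l ?ltr1n.
  rewrite exprSr mulrA ler_wpM2r ?(ltW n0) //.
  apply: (@le_trans _ _ (2 ^+ 10)); first by rewrite -natrX -natrM ler_nat.
  by rewrite lerXn2r ?nnegrE ?(ltW n0) ?ler_nat.
- by lra.
- by rewrite -ME; exact: le_trans Mk0 k0kR.
apply: expands_le expF; rewrite -/x.
have : k%:R * 2 ^+ l <= D%:R :> R by rewrite -natrX -natrM ler_nat; case/andP: kD.
set z := k%:R * _ => zD; have z0 : 0 <= z by rewrite mulr_ge0 // ltW.
have := mulr_ge0 x0 z0; lra.
Qed.

End Expanding.

(** * Transfer to simple graphs *)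

Section DegreeSum.
Variables (E V : finType) (src tgt : E -> V).
Hypothesis loopless : forall e, src e != tgt e.

Lemma sum_deg (F : {set E}) (Z : {set V}) : (\sum_(v in Z) degree src tgt F v =
  edge_cut src tgt F Z + 2 * \sum_(e in F) ((src e \in Z) && (tgt e \in Z)))%N.
Proof.
rewrite exchange_big big_distrr -big_split /=; apply: eq_bigr => e _.
have mem_sum u : (\sum_(v in Z) (u == v) = (u \in Z))%N.
  case: (boolP (u \in Z)) => uZ.
    rewrite (bigD1 u) //= eqxx big1 ?addn0 // => v /andP[_ vu].
    by rewrite eq_sym (negbTE vu).
  by rewrite big1 // => v vZ; case: eqP => // uv; rewrite uv vZ in uZ.
transitivity (\sum_(v in Z) ((src e == v) + (tgt e == v)))%N.
  apply: eq_bigr => v _; rewrite !inE.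
  by have := loopless e; case: (src e =P v) => [->|_]; case: (tgt e =P v) => [->|_];
    rewrite ?eqxx.
rewrite big_split /= !mem_sum.
by case: (_ \in Z); case: (_ \in Z).
Qed.

End DegreeSum.

Section Transfer.
Variables (V : finType) (G : simple_graph V) (A : {set V}).
Hypothesis bip : forall x y, G x y -> (x \in A) != (y \in A).

Definition oriented_edge : finType := {e : V * V | G e.1 e.2 && (e.1 \in A)}.
Notation E := oriented_edge.

Definition left_end (e : E) : V := (val e).1.
Definition right_end (e : E) : V := (val e).2.
Definition to_edge (e : E) : {set V} := [set left_end e; right_end e].

Lemma left_endA e : left_end e \in A. Proof. by case/andP: (valP e). Qed.

Lemma right_endA e : right_end e \notin A.
Proof. by case/andP: (valP e) => /bip + eA; rewrite eA; case: (_ \in A). Qed.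

Lemma left_neq_right e : left_end e != right_end e.
Proof. by apply: contraNneq (right_endA e) => <-; exact: left_endA. Qed.

Lemma to_edge_inj : injective to_edge.
Proof.
move=> e f ef; apply: val_inj; rewrite [val e]surjective_pairing [val f]surjective_pairing.
have tf : left_end e \in to_edge f by rewrite -ef !inE eqxx.
have hf : right_end e \in to_edge f by rewrite -ef !inE eqxx orbT.
congr pair.
  move: tf; rewrite !inE => /orP[/eqP //|/eqP th].
  by move: (right_endA f); rewrite -th left_endA.
move: hf; rewrite !inE => /orP[/eqP ht|/eqP //].
by move: (right_endA e); rewrite ht left_endA.
Qed.

Lemma edges_to_edge : edges G = to_edge @: [set: E].
Proof.
apply/setP => f; rewrite inE.
apply/idP/imsetP => [/existsP[x /existsP[y /andP[xy /eqP ->]]]|[e _ ->]].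
  have := bip xy; have [xA _|xA yA] := boolP (x \in A).
    have pf : G (x, y).1 (x, y).2 && ((x, y).1 \in A) by rewrite /= xy.
    by exists (Sub (x, y) pf) => //; rewrite /to_edge /left_end /right_end !SubK.
  have pf : G (y, x).1 (y, x).2 && ((y, x).1 \in A).
    by rewrite /= adj_sym xy; case: (y \in A) yA.
  by exists (Sub (y, x) pf) => //; rewrite /to_edge /left_end /right_end !SubK setUC.
apply/existsP; exists (left_end e); apply/existsP; exists (right_end e).
by case/andP: (valP e) => -> _; rewrite eqxx.
Qed.

Lemma card_incident (L : {set E}) x :
  #|[set f in to_edge @: L | x \in f]| = degree left_end right_end L x.
Proof.
rewrite /degree -card_crossing -(card_imset (mem (crossing _ _ _ _)) to_edge_inj).
apply: eq_card => f; rewrite inE; apply/andP/imsetP => [[/imsetP[e eL ->]]|[e]].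
  move=> xe; exists e => //; move: xe; rewrite !inE eL /= ![x == _]eq_sym.
  by have := left_neq_right e; case: (left_end e =P x) => [->|_];
    case: (right_end e =P x) => [->|_]; rewrite ?eqxx.
rewrite inE => /andP[eL xe] ->; split; first exact: imset_f.
by move: xe; rewrite !inE ![x == _]eq_sym; case: (left_end e == x); case: (right_end e == x).
Qed.

Lemma deg_oriented v : degree left_end right_end [set: E] v = #|[set y | G v y]|.
Proof.
rewrite -card_incident -edges_to_edge.
have inj : {in [set y | G v y] &, injective (fun y => [set v; y])}.
  move=> y z; rewrite !inE => vy vz /setP/(_ y); rewrite !inE eqxx orbT => /esym/orP[|/eqP //].
  by move=> /eqP yv; move: vy; rewrite yv adj_irr.
rewrite -(card_in_imset inj); apply: eq_card => f; rewrite inE.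
apply/andP/imsetP => [[]|[y]].
  rewrite inE => /existsP[x /existsP[y /andP[xy /eqP ->]]]; rewrite !inE => /orP[]/eqP ->.
    by exists y; rewrite ?inE.
  by exists x; rewrite 1?setUC ?inE // adj_sym.
rewrite inE => vy ->; rewrite !inE eqxx; split=> //.
by apply/existsP; exists v; apply/existsP; exists y; rewrite vy eqxx.
Qed.

Variables (R : realType) (d : nat).
Notation colouring := {ffun E -> 'I_d.+1}.

(** By degree counting, the cut of [Z] has [d.+1 #|Z|] edges less twice those inside. As [G] is
    bipartite, at most [#|Z|^2 / 4] edges lie inside, and [#|Z| <= n <= 3 d.+1 / 2] leaves a quarter
    of [d.+1 #|Z|]. *)
Lemma expands_oriented (n : nat) : #|V| = (2 * n)%N -> (2 * n <= 3 * d.+1)%N ->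
  regular G d.+1 -> expands left_end right_end [set: E] (d.+1%:R / 4 : R).
Proof.
move=> Vn nd regG Z; rewrite Vn => Zn.
have := sum_deg left_neq_right [set: E] Z.
have -> : (\sum_(v in Z) degree left_end right_end [set: E] v = #|Z| * d.+1)%N.
  by rewrite -sum_nat_const; apply: eq_bigr => v _; rewrite deg_oriented regG.
set inner := (\sum_(e in _) _)%N => degs.
have inner_le : (inner <= #|Z :&: A| * #|Z :\: A|)%N.
  rewrite -cardsX.
  apply: (@leq_trans #|[set e : E | val e \in setX (Z :&: A) (Z :\: A)]|).
    rewrite -sum1_card /inner big_mkcond [leqRHS]big_mkcond; apply: leq_sum => e _.
    rewrite !inE -/(left_end e) -/(right_end e) left_endA right_endA andbT.
    by case: (_ \in Z); case: (_ \in Z).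
  rewrite -(card_imset _ (@val_inj _ _ E)) subset_leq_card //.
  by apply/subsetP => _ /imsetP[e + ->]; rewrite inE.
have cA := cardsID A Z.
rewrite mulrAC ler_pdivrMr ?ltr0n // -!natrM ler_nat.
move: (edge_cut left_end right_end [set: E] Z) (#|Z :&: A|) (#|Z :\: A|) inner
  cA Zn degs inner_le => c x y i <- Zn degs ile.
clear -Zn nd degs ile; move: d.+1 nd degs => D nd degs.
have := (nat_AGM2 x y : 4 * (x * y) <= (x + y) * (x + y))%N.
have : ((x + y) * (2 * (x + y)) <= (x + y) * (3 * D))%N by rewrite leq_mul2l; apply/orP; right; lia.
nia.
Qed.

Definition classes (c : colouring) : {ffun 'I_d.+1 -> {set {set V}}} :=
  [ffun i => to_edge @: lab c [set: E] i].

Lemma mem_classes c i e : (to_edge e \in classes c i) = (c e == i).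
Proof. by rewrite ffunE (mem_imset _ _ to_edge_inj) !inE. Qed.

Lemma classes_one_factorization c : factorizes left_end right_end [set: E] 0 d.+1 c ->
  is_one_factorization G (classes c).
Proof.
move=> [_ one]; apply/and3P; split.
- apply/forallP => i; apply/andP; split.
    by rewrite edges_to_edge ffunE imsetS // subsetT.
  by apply/forallP => x; rewrite ffunE card_incident one // leq0n add0n ltn_ord.
- apply/forallP => i; apply/forallP => j; apply/implyP => ij.
  rewrite -setI_eq0; apply/eqP/setP => f; rewrite in_set0 inE; apply/negP => /andP[].
  rewrite {1}ffunE => /imsetP[e]; rewrite !inE => /eqP ci -> {f}.
  by rewrite mem_classes ci (negbTE ij).
- apply/eqP/setP => f; rewrite edges_to_edge; apply/bigcupP/imsetP => [[i _]|[e _ ->]].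
    by rewrite ffunE => /imsetP[e _ ->]; exists e.
  by exists (c e); rewrite ?mem_classes.
Qed.

(** The law of the colour classes. If any colouring meets the event, the sets [S i] are disjoint and
    the event prescribes the colours of exactly [\sum_i #|S i|] edges; otherwise its probability is
    zero. *)
Lemma spread_random_factorization (q : R) : 0 <= q ->
  random_factorization left_end right_end [set: E] 0 d.+1 (@spread_bound E R d q) ->
  exists mu : fdist R (one_factorization G d.+1), spread q mu.
Proof.
move=> q0 [nu [nu0 nu1 supp spr]].
pose m (M : one_factorization G d.+1) : R := \sum_(c | classes c == val M) nu c.
have point c : \sum_(M : one_factorization G d.+1 | classes c == val M) nu c = nu c.
  have [->|c0] := eqVneq (nu c) 0; first by rewrite big1.
  have cP := classes_one_factorization (supp c c0).
  rewrite (big_pred1 (Sub (classes c) cP)) // => M /=.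
  by rewrite -(inj_eq val_inj) SubK eq_sym.
have m0 M : 0 <= m M by apply: sumr_ge0.
have m1 : \sum_M m M = 1.
  by rewrite (exchange_big_dep xpredT) //= -nu1; apply: eq_bigr => c _; exact: point.
exists (FDist m0 m1) => S SE; rewrite /Pr /=.
pose hit c := [forall i, S i \subset classes c i].
apply: (@le_trans _ _ (\sum_(c | hit c) nu c)).
  rewrite (exchange_big_dep hit) /=; last by move=> M c hM /eqP cM; rewrite /hit cM.
  apply: ler_sum => c _; rewrite -[leRHS]point big_mkcondl /=.
  by apply: ler_sum => M _; case: ifP.
have [c0 hc0|none] := pickP hit; last by rewrite (big_pred0 _ _ _ _ none) exprn_ge0.
(* Any colouring in the event must agree with [c0] on the edges of the [S i]. *)
pose T := [set e | to_edge e \in S (c0 e)].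
have preS i : S i = to_edge @: [set e in T | c0 e == i].
  apply/setP => f; apply/idP/imsetP => [fS|[e]].
    have := subsetP (forallP hc0 i) f fS; rewrite {1}ffunE => /imsetP[e].
    rewrite !inE => /eqP ci fe; by exists e; rewrite // !inE ci -fe fS eqxx.
  by rewrite !inE => /andP[+ /eqP <-] ->.
have -> : (\sum_(i < d.+1) #|S i| = #|T|)%N.
  rewrite -[RHS]sum1_card (partition_big c0 xpredT) //=; apply: eq_bigr => i _.
  rewrite preS card_imset; last exact: to_edge_inj.
  by rewrite -sum1_card; apply: eq_bigl => e; rewrite inE.
apply: le_trans (spr T c0 (subsetT _)).
rewrite big_mkcond [leRHS]big_mkcond; apply: ler_sum => c _.
case: ifP => [hc|_]; last by case: ifP.
rewrite ifT //; apply/forall_inP => e; rewrite inE => eS.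
by have := subsetP (forallP hc (c0 e)) _ eS; rewrite mem_classes.
Qed.

End Transfer.

Theorem theorem1p10 (R : realType) :
  exists C alpha : R,
    [/\ 0 < C, 0 < alpha &
      forall n : nat, (1 < n)%N ->
      forall (V : finType) (G : simple_graph V) (d : nat),
        #|V| = (2 * n)%N ->
        bipartite G ->
        regular G d ->
        (1 - alpha) * n%:R <= d%:R ->
        exists mu : fdist R (one_factorization G d),
          spread (C * ln n%:R / n%:R) mu].
Proof.
(* With [alpha = 1 / 3] the degree condition reads [2 n <= 3 d], from which the expansion
   follows. *)
exists (spread_const R), (1 / 3); split; [exact: spread_const_gt0|by lra|].
move=> n n1 V G d Vn [A bip] regG nd.
have {}nd : (2 * n <= 3 * d)%N by rewrite -(ler_nat R) !natrM; lra.
case: d regG nd => [|d] regG nd; first by exfalso; clear -n1 nd; lia.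
have ln0 := ln_ge_half R n1.
apply: (spread_random_factorization bip).
  by rewrite divr_ge0 ?ler0n // mulr_ge0 ?(ltW (spread_const_gt0 R)) //; lra.
apply: (random_factorization_expander (left_endA (A := A)) (right_endA bip) n1 Vn nd (leqnn _)).
  by move=> v; rewrite (deg_oriented bip) regG.
exact: (expands_oriented bip R Vn nd regG).
Qed.
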